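(* Let $G$ be a directed graph and $k\ge 0$ an integer. The collection of all directed forests in $G$ with exactly $k$ arcs (viewed as arc sets) satisfies the weak exchange property: for any two distinct directed forests $F\neq F'$ in $G$ with $|F|=|F'|$, there exist arcs $e\in F\setminus F'$ and $e'\in F'\setminus F$ such that $(F\setminus\{e\})\cup\{e'\}$ is a directed forest in $G$.
   Context: A directed tree is a directed graph whose underlying undirected graph is a tree and in which every vertex except one vertex (the root) has in-degree exactly $1$. A directed forest is a directed graph that is a disjoint union of directed trees; a directed forest in $G$ is a subgraph of $G$ (identified with its arc set) that is a directed forest. $|F|$ denotes the number of arcs of $F$. *)

(* Defs.v *)
From HB Require Import structures.
From mathcomp Require Import all_boot finmap.
Set Implicit Arguments.
Unset Strict Implicit.
Unset Printing Implicit Defensive.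
Local Open Scope fset_scope.

(* Loops, parallel arcs and infinite vertex or arc sets are allowed; a digraph
   given by a relation on its vertices is the case where [darc] is the type of
   related pairs. *)
Record digraph := Digraph {
  dvertex : choiceType;
  darc : choiceType;
  src : darc -> dvertex;
  tgt : darc -> dvertex
}.

(* A finite subgraph of [G] is a pair [(W, T)] of a vertex set and an arc set. *)
Section DirectedForests.
Variable G : digraph.
Implicit Types (W : {fset dvertex G}) (T F : {fset darc G}).

Definition is_subgraph W T : Prop :=
  forall a, a \in T -> src a \in W /\ tgt a \in W.

Definition adjacent T : rel (dvertex G) := fun x y =>
  [exists a : T, ((src (val a), tgt (val a)) == (x, y))
              || ((src (val a), tgt (val a)) == (y, x))].

Definition connected W T : Prop :=
  forall x y, x \in W -> y \in W ->
    exists2 p, path (adjacent T) x p & last x p = y.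

(* In the underlying undirected graph every arc is one edge, so loops are cycles
   of length 1, and parallel or antiparallel pairs of arcs are cycles of length 2.
   A step [(a, b)] traverses [a] from [src a] to [tgt a] if [b], and backwards
   otherwise. *)
Definition step_from (s : darc G * bool) := if s.2 then src s.1 else tgt s.1.
Definition step_to (s : darc G * bool) := if s.2 then tgt s.1 else src s.1.

Definition undirected_cycle (c : seq (darc G * bool)) : bool :=
  [&& c != [::], cycle (fun s t => step_to s == step_from t) c,
      uniq [seq s.1 | s <- c] & uniq [seq step_from s | s <- c]].

Definition acyclic T : Prop :=
  forall c, {subset [seq s.1 | s <- c] <= T} -> ~~ undirected_cycle c.

Definition underlying_tree W T : Prop :=
  [/\ W != fset0, connected W T & acyclic T].

Definition indegree T (v : dvertex G) : nat := #|` [fset a in T | tgt a == v]|.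

Definition directed_tree W T : Prop :=
  [/\ is_subgraph W T, underlying_tree W T &
      exists2 r, r \in W & forall v, v \in W -> (indegree T v == 1) = (v != r)].

(* Isolated vertices are themselves directed trees, so it is immaterial which
   vertex set is attached to the arc set [F]. *)
Definition directed_forest F : Prop :=
  exists ts : seq ({fset dvertex G} * {fset darc G}),
    [/\ forall t, t \in ts -> directed_tree t.1 t.2,
        pairwise (fun t u => [disjoint t.1 & u.1]) ts &
        F = \bigcup_(t <- ts) t.2].

End DirectedForests.

Definition weak_exchange (E : choiceType) (B : {fset E} -> Prop) : Prop :=
  forall F F', B F -> B F' -> F <> F' ->
    exists e e', [/\ e \in F `\` F', e' \in F' `\` F &
                     B ((F `\ e) `|` [fset e'])].

(* Main.v *)
(* A finite arc set is a directed forest iff its arcs have distinct heads and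
   some function from vertices to nat increases along each arc.

   To exchange, let [e' = (u, v)] be an arc of [F' \ F], and climb in [F] from
   [u] towards its root until an arc outside [F'] is met. The vertices visited
   are [F']-ancestors of [u], so [v] is not among them. If the climb reaches the
   root, then [F + e'] has no directed cycle; if it stops at an arc [e], then
   [F - e + e'] has none. So the exchange can only fail if heads collide. If
   some arc of [F'] has a head that is not a head of [F], take it as [e'].
   Otherwise [F] and [F'] have the same heads by counting. If the climb reaches
   the root, remove the arc of [F] into [v]; if it stops at [e], the arc of [F']
   into the head of [e] lies outside [F] and its head comes before [v] in the
   order of [F'], so we may restart from this arc by induction. *)

Require Import Defs.
From mathcomp Require Import all_boot finmap.
Set Implicit Arguments.
Unset Strict Implicit.
Unset Printing Implicit Defensive.
Local Open Scope fset_scope.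

Lemma uniq_map_inj (S R : eqType) (f : S -> R) (s : seq S) :
  uniq (map f s) -> {in s &, injective f}.
Proof.
elim: s => //= z s IHs /andP[z_out Us] x y.
rewrite !inE => /predU1P[->|xs] /predU1P[->|ys] // eq_f; last exact: IHs.
- by case/negP: z_out; rewrite eq_f map_f.
- by case/negP: z_out; rewrite -eq_f map_f.
Qed.

(** * Exchange for arc sets with distinct heads and a rank *)

Section Branchings.
Variable G : digraph.
Implicit Types (F T : {fset darc G}) (W : {fset dvertex G}).
Implicit Types (a e : darc G) (v : dvertex G) (h : dvertex G -> nat).

(** Such an [h] certifies that there is no directed cycle and serves as the induction measure for
    climbs. *)
Definition ranked F h : Prop := {in F, forall a, h (src a) < h (tgt a)}.

Definition branching F : Prop :=
  {in F &, injective (@tgt G)} /\ exists h, ranked F h.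

(** A directed cycle through [e'] would have to enter [A], which holds [src e'] but not [tgt e']; no
    arc of [F] other than [e] does so. *)
Lemma branching_swap F e e' (A : pred (dvertex G)) :
  branching F -> {in F `\ e, forall a, tgt a <> tgt e'} ->
  {in F `\ e, forall a, A (tgt a) -> A (src a)} ->
  A (src e') -> ~~ A (tgt e') -> branching ((F `\ e) `|` [fset e']).
Proof.
move=> [injF [h rk]] tgtNe' clA Asrc /negbTE NAtgt; split.
  move=> a b; rewrite !in_fsetU !in_fset1.
  case/orP=> [aF|/eqP->] /orP[bF|/eqP->] // eq_tgt.
  - by move: aF bF; rewrite !in_fsetD1 => /andP[_ aF] /andP[_ bF]; apply: injF.
  - by case: (tgtNe' _ aF).
  - by case: (tgtNe' _ bF).
(* Lift the vertices outside [A], a set that no remaining arc leaves. *)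
exists (fun x => h x + (if A x then 0 else (h (src e')).+1))%N => a.
rewrite in_fsetU in_fset1 => /orP[aF|/eqP->]; last first.
  by rewrite Asrc NAtgt addn0 addnS ltnS leq_addl.
have lt_a : h (src a) < h (tgt a) by move: aF; rewrite in_fsetD1 => /andP[_ /rk].
case: ifPn => [_|NA]; first by rewrite addn0 ltn_addr.
by rewrite (contraNF (clA a aF) NA) ltn_add2r.
Qed.

(* [A] consists of [u] and its successive [F]-parents, up to the first arc
   outside [F'] or, failing that, up to the root. *)
Lemma ancestors_until_exit F F' h h' (u : dvertex G) :
  {in F &, injective (@tgt G)} -> ranked F h -> ranked F' h' ->
  exists A : pred (dvertex G), [/\ A u, forall x, A x -> h' x <= h' u &
    {in F, forall a, A (tgt a) -> A (src a)} \/
    exists2 e, e \in F `\` F' &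
      A (tgt e) /\ {in F `\ e, forall a, A (tgt a) -> A (src a)}].
Proof.
move=> injF rk rk'; elim/ltn_ind: {u}(h u) {-2}u (erefl (h u)) => n IHn u def_n.
have [/imfsetP[/= a aF def_u]|uroot] := boolP (u \in [fset tgt a | a in F]);
  last first.
  exists (pred1 u); split=> [|x /eqP->|] //=; left=> a aF /eqP eq_u.
  by case/imfsetP: uroot; exists a.
have [aF'|aNF'] := boolP (a \in F'); last first.
  exists (pred1 u); split=> [|x /eqP->|] //=; right; exists a.
    by rewrite in_fsetD aNF'.
  split=> [|b]; first by rewrite def_u.
  rewrite in_fsetD1 => /andP[/eqP neq_ba bF] /eqP eq_u; case: neq_ba.
  by apply: injF => //; rewrite eq_u.
have lt_a : h (src a) < n by rewrite -def_n def_u rk.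
have [A [Asrc leA clA]] := IHn _ lt_a _ erefl.
(* As heads are distinct, [a] is the only arc of [F] into [u], and [src a] is in [A]. *)
have clU b : b \in F -> (A (tgt b) -> A (src b)) ->
    (tgt b == u) || A (tgt b) -> (src b == u) || A (src b).
  move=> bF clb /orP[/eqP eq_u|/clb->]; last by rewrite orbT.
  by rewrite (injF b a bF aF) ?Asrc ?orbT // eq_u.
exists (fun x => (x == u) || A x); split=> [|x /orP[/eqP->//|/leA lex]|].
- by rewrite eqxx.
(* Since [a] lies in [F'], [h'] increases along it, so the bound by [h' (src a)] gives the bound by
   [h' u]. *)
- by rewrite (leq_trans lex) // def_u ltnW // rk'.
case: clA => [clA|[e eFF' [Ae clA]]]; [left=> b bF|right].
  exact: clU bF (clA b bF).
exists e => //; split=> [|b bF]; first by rewrite Ae orbT.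
by apply: clU (clA b bF); move: bF; rewrite in_fsetD1 => /andP[].
Qed.

Lemma branching_exchange F F' :
  branching F -> branching F' -> #|` F| = #|` F'| -> F <> F' ->
  exists e e', [/\ e \in F `\` F', e' \in F' `\` F &
                   branching ((F `\ e) `|` [fset e'])].
Proof.
move=> brF brF' eq_card neqF.
have [injF [h rk]] := brF; have [injF' [h' rk']] := brF'.
have clD1 (A : pred (dvertex G)) e : {in F, forall a, A (tgt a) -> A (src a)} ->
    {in F `\ e, forall a, A (tgt a) -> A (src a)}.
  by move=> clA a; rewrite in_fsetD1 => /andP[_ /clA].
have exit (e' : darc G) : e' \in F' `\` F -> exists A : pred (dvertex G),
    [/\ A (src e'), ~~ A (tgt e'), forall x, A x -> h' x <= h' (src e') &
    {in F, forall a, A (tgt a) -> A (src a)} \/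
    exists2 e, e \in F `\` F' &
      A (tgt e) /\ {in F `\ e, forall a, A (tgt a) -> A (src a)}].
  rewrite in_fsetD => /andP[_ e'F'].
  have [A [Asrc leA clA]] := ancestors_until_exit (src e') injF rk rk'.
  exists A; split=> //; apply/negP => /leA.
  by rewrite leqNgt rk'.
have [heads|] :=
    boolP ([fset tgt a | a in F'] `<=` [fset tgt a | a in F]); last first.
  case/fsubsetPn=> v /imfsetP[/= e' e'F' ->] e'head.
  have tgtNe' a : a \in F -> tgt a <> tgt e'.
    by move=> aF eq_tgt; case/imfsetP: e'head; exists a.
  have e'FF' : e' \in F' `\` F.
    by rewrite in_fsetD e'F' andbT; apply/negP=> /tgtNe'.
  have tgtNe'D e : {in F `\ e, forall a, tgt a <> tgt e'}.
    by move=> a; rewrite in_fsetD1 => /andP[_ /tgtNe'].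
  have [A [Asrc NAtgt _ [clA|[e eFF' [_ clA]]]]] := exit e' e'FF'; last first.
    by exists e, e'; split=> //; apply: branching_swap clA _ _.
  (* The climb reached the root, so any arc of [F] outside [F'] can be removed. *)
  have /fsubsetPn[e eF eNF'] : ~~ (F `<=` F').
    by apply/negP=> sFF'; case: neqF; apply/eqP; rewrite eqEfcard sFF' eq_card /=.
  exists e, e'; split=> //; first by rewrite in_fsetD eNF'.
  exact: branching_swap (clD1 A e clA) _ _.
have eq_heads : [fset tgt a | a in F'] = [fset tgt a | a in F].
  by apply/eqP; rewrite eqEfcard heads !card_in_imfset //= eq_card.
have /fsubsetPn[e0 e0F' e0NF] : ~~ (F' `<=` F).
  by apply/negP=> sFF'; case: neqF; apply/esym/eqP; rewrite eqEfcard sFF' eq_card /=.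
have {e0F' e0NF} e0FF' : e0 \in F' `\` F by rewrite in_fsetD e0NF.
elim/ltn_ind: {e0}(h' (tgt e0)) {-2}e0 (erefl (h' (tgt e0))) e0FF'.
move=> n IHn e' def_n e'FF'.
have [e'NF e'F'] : e' \notin F /\ e' \in F' by apply/andP; rewrite -in_fsetD.
have [A [Asrc NAtgt leA [clA|[e eFF' [Ae _]]]]] := exit e' e'FF'.
  have /imfsetP[/= e eF eq_tgt] : tgt e' \in [fset tgt a | a in F].
    by rewrite -eq_heads; apply/imfsetP; exists e'.
  exists e, e'; split=> //.
    rewrite in_fsetD eF andbT; apply/negP=> eF'; case/negP: e'NF.
    by rewrite (injF' e' e).
  apply: branching_swap (clD1 A e clA) _ _ => // a.
  rewrite in_fsetD1 eq_tgt => /andP[/eqP neq_ae aF] eq_ae.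
  exact: neq_ae (injF a e aF eF eq_ae).
have [eNF' eF] : e \notin F' /\ e \in F by apply/andP; rewrite -in_fsetD.
have /imfsetP[/= f fF' eq_tgt] : tgt e \in [fset tgt a | a in F'].
  by rewrite eq_heads; apply/imfsetP; exists e.
apply: (IHn (h' (tgt f)) _ f erefl).
  (* [tgt f] is [tgt e], a vertex of [A], whence [h' (tgt f) <= h' (src e') < h' (tgt e')]. *)
  by rewrite -eq_tgt -def_n (leq_ltn_trans (leA _ Ae)) // rk'.
rewrite in_fsetD fF' andbT; apply/negP=> fF.
by case/negP: eNF'; rewrite (injF e f).
Qed.

(** * Directed forests have distinct heads and a rank *)

(* The rank of a vertex is the number of vertices from which it can be reached. *)
Lemma acyclic_ranked W T :
  is_subgraph W T -> acyclic T -> exists h, ranked T h.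
Proof.
move=> subWT acT.
pose e := [rel x y : W |
  [exists a : T, (src (val a) == val x) && (tgt (val a) == val y)]].
exists (fun v => if insub v is Some y then #|[pred x : W | connect e x y]| else 0%N).
move=> a aT; have [srcW tgtW] := subWT a aT.
rewrite (insubT (mem W) srcW) (insubT (mem W) tgtW) /=.
set s := Sub (src a) srcW; set t := Sub (tgt a) tgtW.
have est : e s t by apply/existsP; exists [` aT]; rewrite /= !eqxx.
apply/proper_card/properP; split.
  by apply/subsetP=> x; rewrite !inE => /connect_trans-> //; apply: connect1.
(* If [t] reached [s], a simple path from [t] to [s] and an arc back to [t] would form a cycle in
   [T]. *)
exists t; rewrite !inE ?connect0 //; apply/negP=> /connectP[p ep def_s].
case/shortenP: ep def_s => {}p ep Up _ def_s.
set C := t :: p.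
have cycC : cycle e C by rewrite /= rcons_path ep -def_s.
pose arc (x y : W) : darc G := if [pick b : T | (src (val b) == val x) &&
  (tgt (val b) == val y)] is Some b then val b else a.
have arcP (x y : W) : e x y ->
    [/\ arc x y \in T, src (arc x y) = val x & tgt (arc x y) = val y].
  case/existsP=> b exy; rewrite /arc; case: pickP => [c /andP[/eqP ? /eqP ?]|/(_ b)].
    by split=> //; apply: valP.
  by rewrite exy.
pose out x := arc x (next C x).
have outP x : x \in C ->
    [/\ out x \in T, src (out x) = val x & tgt (out x) = val (next C x)].
  by move=> xC; apply: arcP; apply: next_cycle cycC xC.
have Usrc : map (@src G) (map out C) = map val C.
  by rewrite -map_comp; apply/eq_in_map => x /outP[].
have Uval : uniq (map val C) by rewrite (map_inj_uniq val_inj).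
have /acT/negP[] : {subset [seq s.1 | s <- [seq (out x, true) | x <- C]] <= T}.
  by move=> b; rewrite -map_comp => /mapP[x xC ->] /=; case: (outP x xC).
apply/and4P; split=> //.
- rewrite cycle_map; apply: cycle_from_next => // x xC; apply/eqP.
  rewrite /= /step_to /step_from /=.
  have [_ _ ->] := outP x xC.
  by have [_ -> _] := outP (next C x) (etrans (mem_next _ _) xC).
- by rewrite -map_comp; apply: (@map_uniq _ _ (@src G)); rewrite Usrc.
- by rewrite -map_comp -[X in uniq X]/(map (@src G \o out) C) map_comp Usrc.
Qed.

(** At the root, [directed_tree] only excludes in-degree one; in-degree two or more must be ruled
    out for heads to be distinct. *)
Lemma directed_tree_branching W T : directed_tree W T -> branching T.
Proof.
case=> subWT [_ _ acT] [r rW indegE].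
have [h rk] := acyclic_ranked subWT acT.
split; last by exists h.
have [r_in|r_out] := boolP (r \in [fset tgt a | a in T]); last first.
  move=> a b aT bT eq_tgt; have [_ tgtW] := subWT a aT.
  have : tgt a != r.
    by apply: contraNneq r_out => <-; apply/imfsetP; exists a.
  rewrite -(indegE _ tgtW) => /cardfs1P[c def_c].
  have in_c d : d \in T -> tgt d = tgt a -> d = c.
    move=> dT eq_d; apply/eqP; rewrite -in_fset1 -def_c !inE /=.
    by rewrite dT eq_d /=.
  by rewrite (in_c a) // (in_c b).
(* If the root had an incoming arc, so would every vertex, and there would be
   no vertex of minimal rank. *)
suff noW n x : x \in W -> h x = n -> False by case: (noW (h r) r).
elim/ltn_ind: n x => n IHn x xW def_n.
have /imfsetP[/= a aT def_x] : x \in [fset tgt a | a in T].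
  have [->//|neq_xr] := eqVneq x r.
  move: neq_xr; rewrite -(indegE _ xW) => /cardfs1P[c def_c].
  have : c \in [fset c] by rewrite in_fset1.
  rewrite -def_c !inE /= => /andP[cT /eqP <-].
  by apply/imfsetP; exists c.
have [srcW _] := subWT a aT.
by apply: (IHn (h (src a)) _ (src a)) => //; rewrite -def_n def_x rk.
Qed.

(** Vertex-disjoint trees share no head, and no arc joins two of them, so their ranks can be
    glued. *)
Lemma directed_forest_branching F : directed_forest F -> branching F.
Proof.
case=> ts [trees disj ->] {F}.
elim: ts trees disj => [|t ts IHts] trees /=.
  by rewrite big_nil; split=> //; exists (fun=> 0).
case/andP=> /allP disj_t disj_ts; rewrite big_cons.
have tree_t := trees t (mem_head _ _).
have [sub_t _ _] := tree_t.
have [inj_t [ht rkt]] := directed_tree_branching tree_t.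
have tree_ts u : u \in ts -> directed_tree u.1 u.2.
  by move=> uts; apply: trees; rewrite inE uts orbT.
have [injS [hS rkS]] := IHts tree_ts disj_ts.
have outS a : a \in \bigcup_(u <- ts) u.2 -> src a \notin t.1 /\ tgt a \notin t.1.
  case/bigfcupP=> u; rewrite andbT => uts au.
  have [/(_ a au)[srcu tgtu] _ _] := tree_ts u uts.
  have /fdisjointP disj_u := disj_t u uts.
  by split; apply/negP=> /disj_u; rewrite ?srcu ?tgtu.
split=> [a b|].
  rewrite !in_fsetU => /orP[aF|aF] /orP[bF|bF] eq_tgt.
  - exact: inj_t.
  - by case: (outS b bF) => _ /negP[]; rewrite -eq_tgt; case: (sub_t a aF).
  - by case: (outS a aF) => _ /negP[]; rewrite eq_tgt; case: (sub_t b bF).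
  - exact: injS.
exists (fun x => if x \in t.1 then ht x else hS x) => a.
rewrite in_fsetU => /orP[aF|aF].
  by case: (sub_t a aF) => -> ->; apply: rkt.
by case: (outS a aF) => /negbTE-> /negbTE->; apply: rkS.
Qed.

(** * Arc sets with distinct heads and a rank are directed forests *)

(* As heads are distinct, a cycle that follows an arc forwards never turns
   backwards: it is directed, and the rank is monotone along it. *)
Lemma branching_acyclic F : branching F -> acyclic F.
Proof.
case=> injF [h rk] c subcF; apply/negP=> /and4P[c_neq0 cyc Uarc _].
have nextE s : s \in c -> step_to s = step_from (next c s).
  by move=> sc; apply/eqP; apply: (next_cycle cyc).
have inF s : s \in c -> s.1 \in F by move=> sc; apply/subcF/map_f.
(* A forward step followed by a backward one would use two arcs with the same head, hence the same
   arc and the same step. *)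
have next_fwd s : s \in c -> s.2 -> (next c s).2.
  move=> sc fwd_s; apply: contraTT (fwd_s) => bwd_n.
  have nc : next c s \in c by rewrite mem_next.
  have eq_arc : s.1 = (next c s).1.
    apply: injF; rewrite ?inF //.
    by move: (nextE s sc); rewrite /step_to /step_from fwd_s (negbTE bwd_n).
  by rewrite {1}(uniq_map_inj Uarc sc nc eq_arc).
(* Going round the cycle, a transitive relation between consecutive steps relates any two steps,
   even a step to itself. *)
have cycleE (R : rel (darc G * bool)) : transitive R ->
    {in c, forall s, R s (next c s)} -> {in c &, forall s t, R s t}.
  move=> trR nextR; apply/allrelP; rewrite -cycle_all2rel //.
  exact: cycle_from_next (map_uniq Uarc) nextR.
have fwdE : {in c &, forall s t : darc G * bool, s.2 -> t.2}.
  move=> s t sc tc; apply/implyP.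
  apply: (cycleE (fun s t => s.2 ==> t.2)%B) sc tc => [y x z|x xc].
    by case: x.2 y.2 => [] [].
  exact/implyP/next_fwd.
have [s0 s0c] : exists s, s \in c.
  by case: (c) c_neq0 => // s c' _; exists s; apply: mem_head.
(* The rank strictly rises or strictly falls according to the common direction; either way [R s0 s0]
   is absurd. *)
pose R s t := if s0.2 then h (step_from s) < h (step_from t)
              else h (step_from t) < h (step_from s).
have trR : transitive R.
  rewrite /R => t s u; case: s0.2 => [|/[swap]]; exact: ltn_trans.
suff /(cycleE R trR)/(_ s0 s0 s0c s0c) : {in c, forall s, R s (next c s)}.
  by rewrite /R ltnn if_same.
move=> s sc; rewrite /R -nextE // /step_to /step_from.
have -> : s.2 = s0.2 by apply/idP/idP; apply: fwdE.
by case: s0.2; apply: rk; apply: inF.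
Qed.

(** The fibres of [rt] are the vertex sets of the trees. *)
Definition root_map F (rt : dvertex G -> dvertex G) : Prop :=
  {in F, forall a, rt (tgt a) = rt (src a)} /\
  forall v, v \notin [fset tgt a | a in F] -> rt v = v.

(** Iterating the parent map [up] from [v] is stationary after [h v] rounds, as each arc climbed
    lowers [h]. *)
Lemma root_map_exists F : branching F -> exists rt, root_map F rt.
Proof.
case=> injF [h rk].
pose up v := if [pick a : F | tgt (val a) == v] is Some a then src (val a) else v.
have up_tgt : {in F, forall a, up (tgt a) = src a}.
  move=> a aF; rewrite /up; case: pickP => [b /eqP eq_tgt|/(_ [` aF])].
    by congr src; apply: injF (valP b) aF eq_tgt.
  by rewrite /= eqxx.
have up_root v : v \notin [fset tgt a | a in F] -> up v = v.
  move=> v_out; rewrite /up; case: pickP => // b /eqP def_v.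
  by case/negP: v_out; rewrite -def_v; apply/imfsetP; exists (val b);
  rewrite ?(valP b).
have up_fix n v : h v <= n -> up (iter n up v) = iter n up v.
  elim: n v => [|n IHn] v le_n;
    have [/imfsetP[/= a aF def_v]|v_out] := boolP (v \in [fset tgt a | a in F]);
    try by rewrite iter_fix !up_root.
  - by move: (rk a aF); rewrite -def_v ltnNge (leq_trans le_n).
  - rewrite -[up (iter n up v)]iterS iterSr def_v up_tgt // IHn //.
    rewrite -ltnS (leq_trans _ le_n) //.
    by rewrite def_v rk.
exists (fun v => iter (h v) up v); split=> [a aF|v v_out]; last first.
  by rewrite iter_fix // up_root.
have := rk a aF; case: (h (tgt a)) => // n; rewrite ltnS => le_n.
by rewrite iterSr up_tgt // -(subnK le_n) iterD iter_fix // up_fix.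
Qed.

Lemma root_map_root F rt v :
  branching F -> root_map F rt -> rt v \notin [fset tgt a | a in F].
Proof.
case=> injF [h rk] [rt_arc rt_root].
elim/ltn_ind: {v}(h v) {-2}v (erefl (h v)) => n IHn v def_n.
have [/imfsetP[/= a aF def_v]|v_out] := boolP (v \in [fset tgt a | a in F]).
  by rewrite def_v rt_arc //; apply: IHn erefl; rewrite -def_n def_v rk.
by rewrite rt_root.
Qed.

Definition linked T x y := exists2 p, path (adjacent T) x p & last x p = y.

Lemma adjacent_sym T : symmetric (adjacent T).
Proof. by move=> x y; apply: eq_existsb => a; rewrite orbC. Qed.

Lemma linked_trans T y x z : linked T x y -> linked T y z -> linked T x z.
Proof.
case=> p xp <- [q yq <-]; exists (p ++ q); last by rewrite last_cat.
by rewrite cat_path xp.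
Qed.

Lemma linked_sym T x y : linked T x y -> linked T y x.
Proof.
case=> p xp <-; exists (rev (belast x p)).
  by rewrite rev_path; under eq_path do rewrite adjacent_sym.
by case: p {xp} => //= z p; rewrite rev_cons last_rcons.
Qed.

Lemma linked_arc T a : a \in T -> linked T (tgt a) (src a).
Proof.
move=> aT; exists [:: src a] => //=; rewrite andbT.
by apply/existsP; exists [` aT]; rewrite /= eqxx orbT.
Qed.

Section Component.
Variables (F : {fset darc G}) (W : {fset dvertex G}) (rt : dvertex G -> dvertex G).
Hypotheses (brF : branching F) (rtF : root_map F rt) (subWF : is_subgraph W F).

Definition comp_vertices r := [fset v in W | rt v == r].
Definition comp_arcs r := [fset a in F | rt (tgt a) == r].

Lemma comp_arcs_sub r : {subset comp_arcs r <= F}.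
Proof. by move=> a; rewrite !inE => /andP[]. Qed.

Lemma comp_subgraph r : is_subgraph (comp_vertices r) (comp_arcs r).
Proof.
move=> a; rewrite !inE /= => /andP[aF rt_a]; have [srcW tgtW] := subWF aF.
by rewrite srcW tgtW rt_a -rtF.1 // rt_a.
Qed.

(** The climb from [v] to its root stays in the component because [rt] is constant along arcs. *)
Lemma comp_linked r v :
  v \in comp_vertices r -> r \in W /\ linked (comp_arcs r) v r.
Proof.
have [_ [h rk]] := brF.
elim/ltn_ind: {v}(h v) {-2}v (erefl (h v)) => n IHn v def_n vr.
have [/imfsetP[/= a aF def_v]|v_out] := boolP (v \in [fset tgt a | a in F]).
  have ar : a \in comp_arcs r.
    by move: vr; rewrite !inE /= aF def_v => /andP[].
  have lt_n : h (src a) < n by rewrite -def_n def_v rk.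
  have [src_r _] := comp_subgraph ar.
  have [rW link_r] := IHn _ lt_n _ erefl src_r.
  by split=> //; rewrite def_v; apply: linked_trans (linked_arc ar) link_r.
move: vr; rewrite !inE /= rtF.2 // => /andP[vW /eqP <-].
by split=> //; exists [::].
Qed.

(** A head of [F] has exactly one incoming arc, which lies in its component; any other vertex is its
    own root. *)
Lemma comp_indegree v r : v \in comp_vertices r ->
  (indegree (comp_arcs r) v == 1) = (v != r).
Proof.
move=> vr; move: (vr); rewrite !inE /= => /andP[_ /eqP rt_v].
have r_out : r \notin [fset tgt a | a in F] by rewrite -rt_v root_map_root.
have [v_in|v_out] := boolP (v \in [fset tgt a | a in F]).
  have -> : v != r by apply: contraNneq r_out => <-.
  case/imfsetP: v_in => /= a aF def_v; apply/cardfs1P; exists a.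
  apply/fsetP=> b; rewrite !inE /=; apply/andP/eqP=> [[/andP[bF _] /eqP eq_tgt]|->].
    by apply: brF.1 => //; rewrite eq_tgt.
  by rewrite aF -def_v rt_v !eqxx.
rewrite -rt_v rtF.2 // eqxx; apply/negbTE; rewrite /indegree.
apply/cardfs1P=> -[a def_a]; case/negP: v_out.
have : a \in [fset a] by rewrite in_fset1.
rewrite -def_a !inE /= => /andP[/andP[aF _] /eqP <-].
by apply/imfsetP; exists a.
Qed.

Lemma comp_tree v : v \in W ->
  directed_tree (comp_vertices (rt v)) (comp_arcs (rt v)).
Proof.
move=> vW; have v_comp : v \in comp_vertices (rt v) by rewrite !inE /= vW eqxx.
split; first exact: comp_subgraph.
  split; first by apply/fset0Pn; exists v.
    move=> x y /comp_linked[_ xr] /comp_linked[_ yr].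
    exact: linked_trans xr (linked_sym yr).
  move=> c sub_c; apply: (branching_acyclic brF) => a /sub_c.
  exact: comp_arcs_sub.
exists (rt v) => [|w]; last exact: comp_indegree.
rewrite !inE /= (comp_linked v_comp).1 /=.
by rewrite rtF.2 // root_map_root.
Qed.

End Component.

Lemma branching_directed_forest F : branching F -> directed_forest F.
Proof.
move=> brF; have [rt rtF] := root_map_exists brF.
pose W := [fset src a | a in F] `|` [fset tgt a | a in F].
have subWF : is_subgraph W F.
  by move=> a aF; rewrite !in_fsetU !(in_imfset _ (_ : darc G -> _)) ?orbT.
(* One tree per root; listing a finite set of roots avoids repetitions, and distinct fibres are
   disjoint. *)
exists [seq (comp_vertices W rt r, comp_arcs F rt r) | r <- [fset rt v | v in W]].
split=> [t /mapP[r /imfsetP[/= v vW ->] ->]||].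
- exact: comp_tree.
- rewrite pairwise_map; apply: sub_pairwise (_ : pairwise [rel x y | x != y] _).
    move=> r s /= neq_rs; apply/fdisjointP=> v; rewrite !inE /=.
    by move=> /andP[-> /eqP->].
  by rewrite -uniq_pairwise fset_uniq.
apply/fsetP=> a; rewrite big_map; apply/idP/bigfcupP=> [aF|[r _]].
  have [_ tgtW] := subWF a aF.
  by exists (rt (tgt a)); rewrite ?in_imfset // !inE /= aF eqxx.
exact: comp_arcs_sub.
Qed.

End Branchings.

Theorem theorem4 (G : digraph) (k : nat) :
  weak_exchange (fun F : {fset darc G} => directed_forest F /\ #|` F| = k).
Proof.
move=> F F' [forF cardF] [forF' cardF'] neqF.
have eq_card : #|` F| = #|` F'| by rewrite cardF.
have [e [e' [eFF' e'FF' br]]] := branching_exchange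
  (directed_forest_branching forF) (directed_forest_branching forF')
  eq_card neqF.
exists e, e'; split=> //; split; first exact: branching_directed_forest.
move: eFF' e'FF'; rewrite !in_fsetD => /andP[_ eF] /andP[/negbTE e'NF _].
by rewrite fsetUC cardfsU1 in_fsetD1 e'NF andbF -cardF (cardfsD1 e F) eF.
Qed.
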